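(* Let $\mathcal{G}$ be an edgewise filtration on $n$ vertices. Then for any interval $[a,b)$ in the degree $k$ persistence barcode $\mathcal{B}_k(X(\mathcal{G}))$, we have \[2k(k+1) \leq a < b \leq {n-1 \choose 2} +k.\]
   Context: Graphs are finite and simple. An edgewise filtration $\mathcal G=\{G_i\}_{i=1}^m$ on $n$ vertices is a sequence $G_1\subseteq G_2\subseteq\cdots\subseteq G_m$ of graphs on the same set of $n$ vertices in which $G_{i+1}$ and $G_i$ differ by precisely one edge; the indexing is such that $G_i$ has exactly $i$ edges. For a graph $G$, $X(G)$ denotes the flag complex of $G$: the simplicial complex on the vertices of $G$ whose $m$-simplices are the $(m+1)$-cliques of $G$; and $X(\mathcal G)=\{X(G_i)\}_{i=1}^m$. The degree $k$ barcode $\mathcal{B}_k(X(\mathcal G))$ is the collection of intervals in $\{1,\dots,m\}$, written $[a,b)$, that uniquely describes the persistence module $\tilde H_k(X(G_1);\mathbf{k})\to\cdots\to\tilde H_k(X(G_m);\mathbf{k})$ (reduced homology with coefficients in a fixed but arbitrary field $\mathbf{k}$).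
   Formalization: The printed upper bound fails (n=4, k=1: the 4-cycle, then a diagonal, gives the bar [4,5), but C(3,2)+1=4); the bound proved is b ≤ C(n-1,2)+k+1, i.e. the last index b-1 of the bar is at most C(n-1,2)+k; a bar containing m is written [a,m+1). *)

(* Defs.v *)
From HB Require Import structures.
From mathcomp Require Import all_boot all_order all_algebra.

Set Implicit Arguments.
Unset Strict Implicit.
Unset Printing Implicit Defensive.

Import GRing.Theory.
Import Quotient.

Local Open Scope ring_scope.
Local Open Scope quotient_scope.

Record sgraph (n : nat) := SGraph {
  edges : {set {set 'I_n}};
  edges_card : forall e, e \in edges -> #|e| = 2%N
}.

(* The empty simplex is a face; this is what makes the homology below
   reduced. *)
Record scomplex (n : nat) := SComplex {
  faces : {set {set 'I_n}};
  faces0 : set0 \in faces;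
  facesS : forall s t : {set 'I_n}, t \subset s -> s \in faces -> t \in faces
}.

Section FlagComplex.
Variables (n : nat) (G : sgraph n).

Definition is_clique (s : {set 'I_n}) : bool :=
  [forall u in s, forall v in s, (u != v) ==> ([set u; v] \in edges G)].

Definition cliques : {set {set 'I_n}} := [set s | is_clique s].

Lemma cliques0 : set0 \in cliques.
Proof. by rewrite inE; apply/forall_inP => u; rewrite inE. Qed.

Lemma cliquesS (s t : {set 'I_n}) :
  t \subset s -> s \in cliques -> t \in cliques.
Proof.
move=> /subsetP ts; rewrite !inE => /forall_inP cs.
apply/forall_inP => u ut; apply/forall_inP => v vt.
by have /forall_inP := cs u (ts u ut); apply; apply: ts.
Qed.

Definition flag_complex : scomplex n := SComplex cliques0 cliquesS.

End FlagComplex.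

Lemma flag_complexS n (G H : sgraph n) :
  edges G \subset edges H ->
  faces (flag_complex G) \subset faces (flag_complex H).
Proof.
move=> /subsetP GH; apply/subsetP => s; rewrite !inE => /forall_inP cs.
apply/forall_inP => u us; apply/forall_inP => v vs; apply/implyP => uv.
have /forall_inP/(_ v vs)/implyP/(_ uv) := cs u us; exact: GH.
Qed.

(* Only the values graph_at 1, ..., graph_at m are meaningful. *)
Record edgewise_filtration (n m : nat) := EdgewiseFiltration {
  graph_at : nat -> sgraph n;
  graph_at_sub : forall i, (0 < i < m)%N ->
    edges (graph_at i) \subset edges (graph_at i.+1);
  graph_at_step : forall i, (0 < i < m)%N ->
    #|edges (graph_at i.+1) :\: edges (graph_at i)| = 1%N;
  graph_at_card : forall i, (0 < i <= m)%N -> #|edges (graph_at i)| = i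
}.

Section QuotientSpace.
Variables (K : fieldType) (V : vectType K) (U : {vspace V}).

Definition quotv : Type := @quot V (pred_of_vspace U).
HB.instance Definition _ := GRing.Zmodule.on quotv.
HB.instance Definition _ := ZmodQuotient.on quotv.

Definition quotv_scale (a : K) := lift_op1 quotv ( *:%R a).

Lemma pi_scale a : {morph \pi_quotv : x / a *: x >-> quotv_scale a x}.
Proof.
move=> x; unlock quotv_scale; apply/eqP; rewrite piE equivE -scalerBr.
by rewrite rpredZ // idealrBE reprK.
Qed.
Canonical pi_scale_morph a := PiMorph1 (pi_scale a).

Fact quotv_scalerA a b x :
  quotv_scale a (quotv_scale b x) = quotv_scale (a * b) x.
Proof. by rewrite -[x]reprK !piE scalerA. Qed.

Fact quotv_scale1r : left_id 1 quotv_scale.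
Proof. by move=> x; rewrite -[x]reprK !piE scale1r. Qed.

Fact quotv_scalerDr : right_distributive quotv_scale +%R.
Proof.
by move=> a x y; rewrite -[x]reprK -[y]reprK !piE scalerDr.
Qed.

Fact quotv_scalerDl v : {morph quotv_scale^~ v : a b / a + b}.
Proof. by move=> a b; rewrite -[v]reprK !piE scalerDl. Qed.

HB.instance Definition _ := GRing.Zmodule_isLmodule.Build K quotv
  quotv_scalerA quotv_scale1r quotv_scalerDr quotv_scalerDl.

Fact pi_quotv_scalable : scalable \pi_quotv.
Proof. exact: pi_scale. Qed.
HB.instance Definition _ := GRing.isScalable.Build K V quotv *:%R \pi_quotv
  pi_quotv_scalable.

Lemma pi_quotv_eq0 x : (\pi_quotv x == 0) = (x \in U).
Proof. by rewrite -[in RHS](subr0 x) idealrBE raddf0. Qed.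

End QuotientSpace.

Section Homology.
Variables (K : fieldType) (n : nat).

(* All chain groups of all complexes on 'I_n are subspaces of one space; the
   simplex s, oriented by the order of 'I_n, is the basis vector simplex s. *)
Definition chain : vectType K := {ffun {set 'I_n} -> K^o}.

Definition simplex (s : {set 'I_n}) : chain := [ffun t => (t == s)%:R].

Definition boundary_fun (c : chain) : chain :=
  \sum_(s : {set 'I_n}) c s *:
    \sum_(v in s) (-1) ^+ #|[set u in s | (u < v)%N]| *: simplex (s :\ v).

Fact boundary_fun_is_linear : linear boundary_fun.
Proof.
move=> a c d; rewrite /boundary_fun scaler_sumr -big_split /=.
by apply: eq_bigr => s _; rewrite !ffunE scalerDl scalerA.
Qed.
HB.instance Definition _ :=
  GRing.isLinear.Build K chain chain *:%R boundary_fun boundary_fun_is_linear.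

Definition boundary : 'End(chain) := linfun boundary_fun.

Definition chains (X : scomplex n) (k : nat) : {vspace chain} :=
  <<[seq simplex s | s in [set s in faces X | #|s| == k.+1]]>>.

(* In degree 0 the boundary lands in the line of the empty simplex. *)
Definition cycles (X : scomplex n) (k : nat) : {vspace chain} :=
  (chains X k :&: lker boundary)%VS.

Definition boundaries (X : scomplex n) (k : nat) : {vspace chain} :=
  (boundary @: chains X k.+1)%VS.

Definition bounding (X : scomplex n) (k : nat) :
    {vspace subvs_of (cycles X k)} :=
  (linfun vsval @^-1: boundaries X k)%VS.

Definition homology (X : scomplex n) (k : nat) : lmodType K :=
  quotv (bounding X k).

Definition hclass (X : scomplex n) (k : nat) (z : subvs_of (cycles X k)) :
    homology X k :=
  \pi_(quotv (bounding X k)) z.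
HB.instance Definition _ (X : scomplex n) (k : nat) :=
  GRing.Linear.copy (@hclass X k) \pi_(quotv (bounding X k)).

Definition hrepr (X : scomplex n) (k : nat) (x : homology X k) :
    subvs_of (cycles X k) :=
  repr (x : quotv (bounding X k)).

Lemma hreprK (X : scomplex n) (k : nat) : cancel (@hrepr X k) (@hclass X k).
Proof. exact: reprK. Qed.

Lemma hclass_eq0 (X : scomplex n) (k : nat) (z : subvs_of (cycles X k)) :
  (hclass z == 0) = (vsval z \in boundaries X k).
Proof. by rewrite [LHS](pi_quotv_eq0 (bounding X k)) -memv_preim lfunE. Qed.

Section Induced.
Variables (X Y : scomplex n) (k : nat).
Hypothesis sXY : faces X \subset faces Y.

Lemma chainsS j : (chains X j <= chains Y j)%VS.
Proof.
apply: sub_span => c /imageP[s + ->]; rewrite inE => /andP[sX sj].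
by apply: image_f; rewrite inE (subsetP sXY).
Qed.

Lemma cyclesS : (cycles X k <= cycles Y k)%VS.
Proof. by rewrite capvS // chainsS. Qed.

Lemma boundariesS : (boundaries X k <= boundaries Y k)%VS.
Proof. by rewrite limgS // chainsS. Qed.

(* vsproj is the inclusion of cycles here, by cyclesS. *)
Definition homology_map_fun (x : homology X k) : homology Y k :=
  hclass (vsproj (cycles Y k) (vsval (hrepr x))).

Lemma homology_map_funE (z : subvs_of (cycles X k)) :
  homology_map_fun (hclass z) = hclass (vsproj (cycles Y k) (vsval z)).
Proof.
apply/eqP; rewrite /homology_map_fun -subr_eq0 -!linearB hclass_eq0.
rewrite vsprojK; last by rewrite (subvP cyclesS) // subvsP.
by rewrite (subvP boundariesS) // -hclass_eq0 linearB /= hreprK subrr.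
Qed.

Fact homology_map_fun_is_linear : linear homology_map_fun.
Proof.
move=> a x y; rewrite -[x]hreprK -[y]hreprK -linearP !homology_map_funE.
by rewrite !linearP.
Qed.
HB.instance Definition _ := GRing.isLinear.Build K (homology X k)
  (homology Y k) *:%R homology_map_fun homology_map_fun_is_linear.

Definition homology_map : {linear homology X k -> homology Y k} :=
  homology_map_fun.

End Induced.
End Homology.

(* Persistence modules indexed by {1, ..., m}, given by their consecutive
   structure maps; the spaces at other indices are ignored. *)
Record pmodule (K : fieldType) (m : nat) := PModule {
  pm_space : nat -> lmodType K;
  pm_map : forall i, (0 < i < m)%N -> {linear pm_space i -> pm_space i.+1}
}.

Definition pmodule_iso (K : fieldType) (m : nat) (M N : pmodule K m) : Prop :=
  exists phi : forall i, {linear pm_space M i -> pm_space N i},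
    (forall i, (0 < i <= m)%N -> bijective (phi i)) /\
    (forall i (hi : (0 < i < m)%N) (x : pm_space M i),
       phi i.+1 (pm_map M hi x) = pm_map N hi (phi i x)).

Section IntervalModules.
Variables (K : fieldType) (m : nat) (B : seq (nat * nat)).

(* Index i lies in the j-th interval [a, b) of B. *)
Definition alive (i : nat) (j : 'I_(size B)) : bool :=
  ((tnth (in_tuple B) j).1 <= i < (tnth (in_tuple B) j).2)%N.

Definition interval_space (i : nat) : lmodType K :=
  {ffun {j : 'I_(size B) | alive i j} -> K^o}.

Definition interval_map_fun (i i' : nat) (f : interval_space i) :
    interval_space i' :=
  [ffun j => if insub (val j) is Some j' then f j' else 0].

Fact interval_map_fun_is_linear i i' : linear (@interval_map_fun i i').
Proof.
move=> a f g; apply/ffunP => j; rewrite !ffunE.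
by case: insubP => [j' _ _|_]; rewrite ?ffunE // scaler0 addr0.
Qed.
HB.instance Definition _ i i' := GRing.isLinear.Build K (interval_space i)
  (interval_space i') *:%R (@interval_map_fun i i')
  (@interval_map_fun_is_linear i i').

(* The direct sum of the interval modules of B. *)
Definition interval_sum : pmodule K m :=
  @PModule K m interval_space (fun i _ => @interval_map_fun i i.+1).

End IntervalModules.

(* B lists the barcode of M with multiplicity; a pair (a, b) stands for the
   nonempty interval [a, b) of {1, ..., m}, so that b = m + 1 when the interval
   contains m. *)
Definition is_barcode (K : fieldType) (m : nat) (M : pmodule K m)
    (B : seq (nat * nat)) : Prop :=
  (forall a b, (a, b) \in B -> (0 < a < b)%N && (b <= m.+1)%N) /\
  pmodule_iso M (interval_sum K m B).

(* The degree k persistent reduced homology of the filtration X(G_1), ...,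
   X(G_m) by flag complexes. *)
Definition flag_homology (K : fieldType) (n m : nat)
    (G : edgewise_filtration n m) (k : nat) : pmodule K m :=
  @PModule K m (fun i => homology K (flag_complex (graph_at G i)) k)
    (fun i hi => homology_map K k (flag_complexS (graph_at_sub G hi))).

(* Main.v *)
Require Import Defs.
From mathcomp Require Import all_boot all_order all_algebra.
From mathcomp Require Import zify.

(** An interval [a, b) of the barcode makes the degree k homology of X(G_i)
    nonzero for every i with a <= i < b, and G_i has i edges.  Hence the claim
    reduces to two statements about one graph G on n vertices with nonzero
    reduced homology of X(G) in degree k: G has at least 2k(k+1) edges, and its
    complement has at least n - 1 - k edges.  The second one gives
    b - 1 <= 'C(n, 2) - (n - 1 - k) = 'C(n-1, 2) + k.

    Both follow by induction on a vertex set S, for the flag complex X[S] of the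
    subgraph induced on S.  For a vertex v of S, X[S] is the union of X[S - v]
    and the cone from v over X[N], where N is the set of neighbors of v in S;
    the two pieces meet in X[N].  So, as in Mayer-Vietoris, a nonzero class of
    degree k in X[S] forces one of degree k in X[S - v] or one of degree k - 1
    in X[N] [acyclic_mayer_vietoris].  And v is not adjacent to all other
    vertices of S, since X[S] would be a cone [acyclic_dominated].  With |N| <=
    |S| - 2 this yields three bounds for nonzero homology in degree k:

    - |S| >= 2k + 2 [acyclic_few_vertices], because N has at least 2k vertices
      in the second case;
    - at least 2k(k+1) edges [acyclic_few_edges]: if deleting any vertex kills
      the degree k homology, then every degree is at least 2k by the first
      bound, and there are at least 2k + 2 vertices; otherwise delete a vertex
      that keeps the homology nonzero;
    - at least |S| - 1 - k nonedges [acyclic_few_nonedges]: deleting v loses a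
      vertex and at least one nonedge; passing to N and to degree k - 1 loses v
      and its d nonneighbors, but also the d nonedges at v.

    The chain-level argument uses explicit cones, so that only the formula
    d(cone e) = e - cone (d e) about the boundary d enters. *)
Set Implicit Arguments.
Unset Strict Implicit.
Unset Printing Implicit Defensive.

Import GRing.Theory.

Local Open Scope ring_scope.

(** * Cones over chains and the decomposition of a chain at a vertex *)

Section Cones.
Variables (K : fieldType) (n : nat).
Implicit Types (c d e : chain K n) (s t S : {set 'I_n}) (u v : 'I_n).

Definition face_sign v s : K := (-1) ^+ #|[set u in s | (u < v)%N]|.

Lemma face_signU v u s : u \notin s ->
  face_sign v (u |: s) = (-1) ^+ (u < v)%N * face_sign v s.
Proof.
move=> us; rewrite /face_sign -exprD; congr (_ ^+ _).
rewrite (cardsD1 u) !inE eqxx /=; congr (_ + #|pred_of_set _|)%N.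
apply/setP=> w; rewrite !inE; case: (eqVneq w u) => //= ->.
by rewrite (negbTE us).
Qed.

Lemma face_signUl v s : face_sign v (v |: s) = face_sign v s.
Proof.
have [vs|vs] := boolP (v \in s); first by rewrite (setUidPr _) ?sub1set.
by rewrite face_signU // ltnn mul1r.
Qed.

Lemma face_sign_sqr v s : face_sign v s * face_sign v s = 1.
Proof. by rewrite /face_sign -expr2 sqrr_sign. Qed.

(** Coefficientwise form of the boundary: it turns identities between chains
    into sign computations for a fixed simplex, without sums over simplices. *)
Lemma boundaryE c t : boundary K n c t =
  \sum_(v | v \notin t) face_sign v t * c (v |: t).
Proof.
rewrite /boundary lfunE /= /boundary_fun sum_ffunE.
transitivity
  (\sum_(s : {set 'I_n}) \sum_(v in s | s :\ v == t) face_sign v s * c s).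
  apply: eq_bigr => s _; rewrite ffunE sum_ffunE big_mkcondr scaler_sumr /=.
  apply: eq_bigr => v vs; rewrite !ffunE eq_sym.
  case: eqP => _; last by rewrite !scaler0.
  by rewrite [LHS]mulrC [X in X * _]mulr1.
rewrite (exchange_big_dep predT) //= [RHS]big_mkcond /=; apply: eq_bigr => v _.
case: ifP => vt.
  rewrite (big_pred1 (v |: t)) ?face_signUl // => s /=.
  apply/andP/eqP => [[vs /eqP <-]|->]; first by rewrite setD1K.
  by rewrite setU11 setU1K.
rewrite big_pred0 // => s; apply/negP => /andP[_ /eqP ts].
by rewrite -ts !inE eqxx in vt.
Qed.

Definition cone v e : chain K n :=
  [ffun t : {set 'I_n} => if v \in t then face_sign v t * e (t :\ v) else 0].

(** The cone from [v] contracts the complex of chains off [v].  At a simplex that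
    contains [v] the terms for [u <> v] cancel, since exchanging the two
    vertices changes the order of exactly one pair. *)
Lemma boundary_cone v e : (forall t, v \in t -> e t = 0) ->
  boundary K n (cone v e) = e - cone v (boundary K n e).
Proof.
move=> ev; apply/ffunP => t; rewrite boundaryE !ffunE; case: ifP => vt; last first.
  rewrite oppr0 addr0 (bigD1 v) ?vt //= ffunE setU11 setU1K ?vt //.
  rewrite face_signUl mulrA face_sign_sqr mul1r big1 ?addr0 // => u /andP[_ uv].
  by rewrite ffunE !inE vt eq_sym (negbTE uv) mulr0.
rewrite ev // add0r boundaryE mulr_sumr -sumrN.
rewrite [RHS](bigD1 v) ?setD11 //= ev ?setU11 // !mulr0 oppr0 add0r.
apply: eq_big => [u|u ut].
  by rewrite !inE; case: eqVneq => [->|_] /=; rewrite ?vt ?andbT.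
have uv : u != v by apply: contraNneq ut => ->.
rewrite ffunE !inE vt orbT mulrA.
have -> : (u |: t) :\ v = u |: (t :\ v).
  by apply/setP=> w; rewrite !inE; case: (eqVneq w u) => //= ->; rewrite uv.
rewrite mulrA -mulNr; congr (_ * _).
rewrite face_signU // -{1}(setD1K vt) face_signU ?setD11 //.
have opp_signs : (-1) ^+ (v < u)%N * (-1) ^+ (u < v)%N = -1 :> K.
  rewrite -exprD (_ : (_ + _)%N = 1%N) //.
  by move: uv; rewrite -val_eqE /=; case: ltngtP.
by rewrite mulrACA opp_signs mulN1r mulrC.
Qed.

Definition deletion v c : chain K n :=
  [ffun t : {set 'I_n} => if v \in t then 0 else c t].

Definition link v c : chain K n :=
  [ffun t : {set 'I_n} => if v \in t then 0 else face_sign v t * c (v |: t)].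

(** The splitting that underlies Mayer-Vietoris: [deletion v c] is the part of [c]
    away from [v], and the rest is a cone over the link part. *)
Lemma deletion_cone_link v c : c = deletion v c + cone v (link v c).
Proof.
apply/ffunP => t; rewrite !ffunE; case: ifP => vt; last by rewrite addr0.
rewrite setD11 mulrA -[in face_sign _ (t :\ v)]face_signUl setD1K //.
by rewrite face_sign_sqr mul1r add0r.
Qed.

Section CycleParts.
Variables (v : 'I_n) (c : chain K n).
Hypothesis zc : boundary K n c = 0.

Lemma boundary_deletion : boundary K n (deletion v c) = - link v c.
Proof.
apply/ffunP => t; rewrite boundaryE !ffunE; case: ifP => vt.
  by rewrite oppr0 big1 // => u _; rewrite ffunE !inE vt orbT mulr0.
have /eqP := congr1 (fun f : chain K n => f t) zc.
rewrite boundaryE ffunE (bigD1 v) ?vt //= addr_eq0 => /eqP ->; rewrite opprK.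
rewrite (bigD1 v) ?vt //= ffunE setU11 mulr0 add0r.
by apply: eq_bigr => u /andP[_ uv]; rewrite ffunE !inE vt eq_sym (negbTE uv).
Qed.

(** Taking boundaries in [deletion_cone_link] leaves [cone v (d (link v c)) = 0],
    and the cone is injective on chains off [v]. *)
Lemma boundary_link : boundary K n (link v c) = 0.
Proof.
have e0 t : v \in t -> link v c t = 0 by move=> vt; rewrite ffunE vt.
have cone0 : cone v (boundary K n (link v c)) = 0.
  have := zc; rewrite {1}(deletion_cone_link v c) linearD /= boundary_cone //.
  by rewrite boundary_deletion addrA addNr add0r => /eqP; rewrite oppr_eq0 => /eqP.
apply/ffunP => t; rewrite [RHS]ffunE.
have [vt|vt] := boolP (v \in t).
  by rewrite boundaryE big1 // => u _; rewrite e0 ?mulr0 // setU1r.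
have /(congr1 ( *%R (face_sign v t))) :=
  congr1 (fun f : chain K n => f (v |: t)) cone0.
by rewrite !ffunE setU11 setU1K // face_signUl mulrA face_sign_sqr mul1r mulr0.
Qed.

End CycleParts.

End Cones.

(** * Acyclicity of induced flag complexes *)

Section FlagAcyclicity.
Variables (K : fieldType) (n : nat) (G : sgraph n).
Implicit Types (c d e : chain K n) (s t S : {set 'I_n}) (u v : 'I_n) (j k : nat).

(** The index [j] is the number of vertices of the simplices, hence the degree
    plus one: this lets degree -1 appear as [j = 0] and start the inductions. *)
Definition clique_chain S j c := forall s, c s != 0 ->
  [/\ is_clique G s, s \subset S & #|s| = j].

Definition acyclic_on S j := forall c, clique_chain S j c ->
  boundary K n c = 0 -> exists2 d, clique_chain S j.+1 d & boundary K n d = c.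

Definition neighbors S v : {set 'I_n} :=
  [set u in S :\ v | [set v; u] \in edges G].

Lemma clique_sub s t : t \subset s -> is_clique G s -> is_clique G t.
Proof. by move=> ts cs; have := @cliquesS n G s t ts; rewrite !inE; apply. Qed.

Lemma clique_edge s u v : is_clique G s -> u \in s -> v \in s -> u != v ->
  [set u; v] \in edges G.
Proof. by move=> /forall_inP cs /cs/forall_inP/[apply]/implyP/[apply]. Qed.

Lemma clique_add S s v : is_clique G s -> s \subset neighbors S v ->
  is_clique G (v |: s).
Proof.
move=> cs /subsetP sN.
have vN u : u \in s -> [set v; u] \in edges G.
  by move=> /sN; rewrite inE => /andP[].
apply/forall_inP => x /setU1P[->|xs]; apply/forall_inP => y /setU1P[->|ys];
  apply/implyP => xy.
- by rewrite eqxx in xy.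
- exact: vN.
- by rewrite setUC; apply: vN.
- exact: clique_edge cs _ _ _.
Qed.

Lemma clique_chainD S j c d :
  clique_chain S j c -> clique_chain S j d -> clique_chain S j (c + d).
Proof.
move=> cc cd s; have [c0|c0 _] := eqVneq (c s) 0; last exact: cc.
by rewrite ffunE c0 add0r; apply: cd.
Qed.

Lemma clique_chainN S j c : clique_chain S j c -> clique_chain S j (- c).
Proof. by move=> cc s; rewrite ffunE oppr_eq0; apply: cc. Qed.

Lemma clique_chainS S (T : {set 'I_n}) j c : S \subset T ->
  clique_chain S j c -> clique_chain T j c.
Proof.
by move=> ST cc s /cc[cs sS sj]; split=> //; apply: subset_trans ST.
Qed.

Lemma clique_chain_cone S j v e : v \in S ->
    (forall t, v \in t -> e t = 0) ->
    (forall s, e s != 0 -> [/\ is_clique G (v |: s), s \subset S & #|s| = j]) ->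
  clique_chain S j.+1 (cone v e).
Proof.
move=> vS ev ce s; rewrite ffunE; case: ifP => [vs|_]; last by rewrite eqxx.
rewrite mulf_eq0 negb_or => /andP[_] /ce[]; rewrite setD1K // => cs sS sj.
split=> //; last by rewrite (cardsD1 v) vs sj.
by rewrite -(setD1K vs) subUset sub1set vS.
Qed.

Lemma clique_chain_deletion S j v c :
  clique_chain S j c -> clique_chain (S :\ v) j (deletion v c).
Proof.
move=> cc s; rewrite ffunE; case: ifP => vs; first by rewrite eqxx.
by move=> /cc[cs sS sj]; split=> //; rewrite subsetD1 sS vs.
Qed.

Lemma clique_chain_link S j v c :
  clique_chain S j.+1 c -> clique_chain (neighbors S v) j (link v c).
Proof.
move=> cc s; rewrite ffunE; case: ifP => vs; first by rewrite eqxx.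
rewrite mulf_eq0 negb_or => /andP[_] /cc[cs sS sj]; split.
- exact: clique_sub (subsetUr _ _) cs.
- apply/subsetP => u us; have uv : u != v by apply: contraFneq vs => <-.
  rewrite !inE uv (subsetP sS) ?setU1r //=.
  by apply: clique_edge cs _ _ _; rewrite ?setU11 ?setU1r // eq_sym.
- by move: sj; rewrite cardsU1 vs => -[].
Qed.

(** A cycle [c] in a cone with apex [v] is the boundary of the cone over its part
    off [v].  Only the cliques with [j] vertices need to extend by [v], so the
    case [j = 0] applies to every [v] in [S]. *)
Lemma acyclic_cone S j v : v \in S ->
    (forall s, is_clique G s -> s \subset S -> #|s| = j ->
       is_clique G (v |: s)) ->
  acyclic_on S j.
Proof.
move=> vS vcone c cc zc.
have dv t : v \in t -> deletion v c t = 0 by move=> vt; rewrite ffunE vt.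
exists (cone v (deletion v c)); last first.
  rewrite boundary_cone // boundary_deletion //.
  rewrite [RHS](deletion_cone_link v); congr (_ + _).
  by apply/ffunP => t; rewrite !ffunE; case: ifP => _;
    rewrite ?oppr0 ?mulr0 ?mulrN ?opprK.
apply: clique_chain_cone => // s /(clique_chain_deletion cc)[cs sS sj].
have {}sS := subset_trans sS (subsetDl _ _).
by split=> //; apply: vcone.
Qed.

Lemma acyclic_dominated S j v : v \in S -> neighbors S v = S :\ v ->
  acyclic_on S j.
Proof.
move=> vS Nv; apply: (acyclic_cone vS) => s cs sS _.
have [vs|vs] := boolP (v \in s); first by rewrite (setUidPr _) ?sub1set.
by apply: (@clique_add S) => //; rewrite Nv subsetD1 sS.
Qed.

Lemma acyclic_empty_simplex S v : v \in S -> acyclic_on S 0.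
Proof.
move=> vS; apply: (acyclic_cone vS) => s _ _ /cards0_eq ->.
apply: (@clique_add S); last exact: sub0set.
by have := @cliques0 n G; rewrite inE.
Qed.

(** The step of the Mayer-Vietoris sequence for X[S] as the union of X[S - v] and
    the cone over X[N(v)].  The link part of a cycle [c] is a cycle, so it is
    the boundary of some [f] in N(v); replacing the cone over it by [f] moves
    [c], up to a boundary, to the cycle [deletion v c + f] off [v]. *)
Lemma acyclic_mayer_vietoris S j v : v \in S ->
  acyclic_on (S :\ v) j.+1 -> acyclic_on (neighbors S v) j -> acyclic_on S j.+1.
Proof.
move=> vS aD aN c cc zc.
have [f cf fE] := aN _ (clique_chain_link cc) (boundary_link v zc).
have NsubD : neighbors S v \subset S :\ v.
  by apply/subsetP => u; rewrite inE => /andP[].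
have f0 t : v \in t -> f t = 0.
  move=> vt; apply/eqP/negPn/negP => /cf[_ /subsetP/(_ v vt)].
  by rewrite !inE eqxx.
have cdf : clique_chain (S :\ v) j.+1 (deletion v c + f).
  by apply: clique_chainD (clique_chain_deletion cc) (clique_chainS NsubD cf).
have zdf : boundary K n (deletion v c + f) = 0.
  by rewrite linearD /= boundary_deletion // fE addNr.
have [g cg gE] := aD _ cdf zdf.
exists (g - cone v f).
  apply: clique_chainD; first exact: clique_chainS (subsetDl _ _) cg.
  apply/clique_chainN/clique_chain_cone => // s /cf[cs sN sj].
  split=> //; first exact: clique_add sN.
  exact: subset_trans sN (subset_trans NsubD (subsetDl _ _)).
rewrite linearB /= gE boundary_cone // fE [RHS](deletion_cone_link v).
by rewrite opprB addrA addrAC addrK.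
Qed.

Lemma acyclic_set0 j : acyclic_on set0 j.+1.
Proof.
move=> c cc _; exists 0 => [s|]; first by rewrite ffunE eqxx.
rewrite linear0; apply/ffunP => s; rewrite ffunE; apply/esym/eqP/negPn/negP.
by move=> /cc[_]; rewrite subset0 => /eqP ->; rewrite cards0.
Qed.

End FlagAcyclicity.

(** * Counting edges and nonedges inside a vertex set *)

Section PairCounting.
Variables (n : nat) (D : {set {set 'I_n}}).
Hypothesis D2 : forall x, x \in D -> #|x| = 2%N.
Implicit Types (S : {set 'I_n}) (u v : 'I_n).

Definition pairs_in S := [set x in D | x \subset S].

Definition pairs_at S v := [set x in pairs_in S | v \in x].

Lemma card_pairs_in_delete S v :
  #|pairs_in S| = (#|pairs_at S v| + #|pairs_in (S :\ v)|)%N.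
Proof.
rewrite -(cardsID [set x : {set 'I_n} | v \in x]); congr (_ + _)%N.
  by apply: eq_card => x; rewrite !inE.
by apply: eq_card => x; rewrite !inE subsetD1 andbC andbA.
Qed.

(** A pair at [v] is determined by its other vertex. *)
Lemma card_pairs_at S v : v \in S ->
  #|pairs_at S v| = #|[set u in S :\ v | [set v; u] \in D]|.
Proof.
move=> vS; set N := [set u in _ | _].
rewrite -(card_in_imset (f := fun u => [set v; u]) (D := N)).
  apply: eq_card => x; apply/idP/imsetP => [|[u]].
    rewrite !inE => /andP[/andP[xD xS] vx].
    have /eqP/cards2P[p [q [pq xE]]] := D2 xD.
    have [u uv {p q pq}xE] : exists2 u, u != v & x = [set v; u].
      move: vx; rewrite xE !inE => /orP[]/eqP ->.
        by exists q => //; rewrite eq_sym.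
      by exists p => //; rewrite setUC.
    exists u => //; rewrite !inE uv -xE xD (subsetP xS) // xE !inE eqxx orbT //.
  rewrite !inE => /andP[/andP[uv uS] uD] ->.
  by rewrite uD subUset !sub1set vS uS set21.
move=> u w; rewrite !inE => /andP[/andP[uv _] _] _ /setP/(_ u).
by rewrite !inE eqxx orbT (negbTE uv) /= => /esym/eqP.
Qed.

(** The handshake lemma: every pair is counted once at each of its two ends. *)
Lemma sum_card_pairs_at S :
  (\sum_(v in S) #|pairs_at S v| = 2 * #|pairs_in S|)%N.
Proof.
transitivity (\sum_(v in S) \sum_(x in pairs_in S | v \in x) 1)%N.
  by apply: eq_bigr => v _; rewrite -sum1_card;
    apply: eq_bigl => x; rewrite !inE.
rewrite (exchange_big_dep (mem (pairs_in S))) /=; last by move=> v x _ /andP[].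
rewrite mulnC -sum_nat_const; apply: eq_bigr => x; rewrite inE => /andP[xD xS].
rewrite sum1dep_card -(D2 xD); apply: eq_card => v; rewrite !inE xD xS /=.
by case vx: (v \in x); rewrite ?andbF // (subsetP xS).
Qed.

End PairCounting.

Lemma pairs_inS n (D : {set {set 'I_n}}) (S T : {set 'I_n}) : S \subset T ->
  (#|pairs_in D S| <= #|pairs_in D T|)%N.
Proof.
move=> ST; apply/subset_leq_card/subsetP => x; rewrite !inE => /andP[-> xS].
exact: subset_trans ST.
Qed.

Lemma pairs_inT n (D : {set {set 'I_n}}) : pairs_in D [set: 'I_n] = D.
Proof. by apply/setP => x; rewrite inE subsetT andbT. Qed.

(** * Few vertices, few edges or few nonedges force acyclicity *)

(** Inferring the finite type of ordinals in different ways gives convertible but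
    not syntactically equal cardinalities, which [lia] takes for distinct
    atoms. *)
Ltac card_lia := unfold reverse_coercion in *; lia.

Section AcyclicityBounds.
Variables (K : fieldType) (n : nat) (G : sgraph n).
Implicit Types (S : {set 'I_n}) (j k : nat).

Definition nonedges : {set {set 'I_n}} :=
  [set x : {set 'I_n} | #|x| == 2%N] :\: edges G.

Lemma nonedges_card x : x \in nonedges -> #|x| = 2%N.
Proof. by rewrite !inE => /andP[_ /eqP]. Qed.

Lemma card_neighbors S v : v \in S ->
  #|pairs_at (edges G) S v| = #|neighbors G S v|.
Proof. by move=> vS; rewrite (card_pairs_at (@edges_card n G)). Qed.

Lemma card_neighbors_nonedges S v : v \in S ->
  #|S| = (#|neighbors G S v| + #|pairs_at nonedges S v|).+1.
Proof.
move=> vS; rewrite (card_pairs_at nonedges_card) // (cardsD1 v) vS add1n.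
congr _.+1; rewrite -(cardsID [set u : 'I_n | [set v; u] \in edges G]).
congr (_ + _)%N; apply: eq_card => u; rewrite !inE //.
by rewrite cards2 (eq_sym v); case: (eqVneq u v) => /=;
  rewrite ?andbF ?andbT // andbC.
Qed.

Lemma neighbors_full S v : v \in S -> pairs_at nonedges S v = set0 ->
  neighbors G S v = S :\ v.
Proof.
move=> vS N0; apply/eqP; rewrite eqEcard; apply/andP; split.
  by apply/subsetP => u; rewrite inE => /andP[].
have := card_neighbors_nonedges vS.
by rewrite N0 cards0 addn0 (cardsD1 v) vS add1n => -[->].
Qed.

(** Lowering [j] by one costs at least two vertices: a vertex [v] and some
    nonneighbor of [v].  The bound is attained by the boundary of the
    cross-polytope, with two vertices on each of [j] axes. *)
Lemma acyclic_few_vertices S j : (#|S| < 2 * j)%N -> acyclic_on K G S j.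
Proof.
have [N] := ubnP #|S|; elim: N S j => // N IH S [|j] SN Sj; first lia.
have [->|/set0Pn[v vS]] := eqVneq S set0; first exact: acyclic_set0.
have [N0|/set0Pn[x xN]] := eqVneq (pairs_at nonedges S v) set0.
  exact: acyclic_dominated (neighbors_full vS N0).
have cS := card_neighbors_nonedges vS.
have dS : #|S| = #|S :\ v|.+1 by rewrite (cardsD1 v) vS.
have : (0 < #|pairs_at nonedges S v|)%N by apply/card_gt0P; exists x.
by move=> N0; apply: (acyclic_mayer_vietoris vS); apply: IH; card_lia.
Qed.

(** By the handshake lemma some vertex has degree below [2 * k], unless [S] has
    fewer than [2 * k.+1] vertices.  The link of that vertex is acyclic because
    it has few vertices, so the vertex can be deleted. *)
Lemma acyclic_few_edges S k : (#|pairs_in (edges G) S| < 2 * k * (k + 1))%N ->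
  acyclic_on K G S k.+1.
Proof.
have [N] := ubnP #|S|; elim: N S => // N IH S SN Sk.
have [Ssmall|Sbig] := ltnP #|S| (2 * k.+1); first exact: acyclic_few_vertices.
have [v vS dv] : exists2 v, v \in S & (#|neighbors G S v| < 2 * k)%N.
  apply/exists_inP; apply: contraT => /exists_inPn high.
  have : (\sum_(v in S) 2 * k <= \sum_(v in S) #|pairs_at (edges G) S v|)%N.
    by apply: leq_sum => v vS; rewrite card_neighbors // leqNgt high.
  rewrite sum_nat_const (sum_card_pairs_at (@edges_card n G)); nia.
have dS : #|S| = #|S :\ v|.+1 by rewrite (cardsD1 v) vS.
apply: (acyclic_mayer_vietoris vS); last exact: acyclic_few_vertices.
apply: IH; first card_lia.
exact: leq_ltn_trans (pairs_inS _ (subsetDl _ _)) Sk.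
Qed.

(** In both branches of the Mayer-Vietoris step the slack in the hypothesis
    survives.  Deleting [v] removes one vertex and at least one nonedge; passing
    to the neighbors of [v], with [j] lowered by one, removes [d + 1] vertices
    and at least [d] nonedges, where [d] counts the nonneighbors of [v]. *)
Lemma acyclic_few_nonedges S j : (#|pairs_in nonedges S| + j < #|S|)%N ->
  acyclic_on K G S j.
Proof.
have [N] := ubnP #|S|; elim: N S j => // N IH S j SN Sj.
have /card_gt0P[v vS] : (0 < #|S|)%N by lia.
case: j Sj => [|j] Sj; first exact: acyclic_empty_simplex vS.
have [N0|/set0Pn[x xN]] := eqVneq (pairs_at nonedges S v) set0.
  exact: acyclic_dominated (neighbors_full vS N0).
have : (0 < #|pairs_at nonedges S v|)%N by apply/card_gt0P; exists x.
have cS := card_neighbors_nonedges vS.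
have eS := card_pairs_in_delete nonedges S v.
have dS : #|S| = #|S :\ v|.+1 by rewrite (cardsD1 v) vS.
have : (#|pairs_in nonedges (neighbors G S v)| <=
        #|pairs_in nonedges (S :\ v)|)%N.
  by apply: pairs_inS; apply/subsetP => u; rewrite inE => /andP[].
by move=> NS N0; apply: (acyclic_mayer_vietoris vS); apply: IH; card_lia.
Qed.

Lemma card_edges_nonedges : (#|edges G| + #|nonedges| = 'C(n, 2))%N.
Proof.
rewrite -[X in 'C(X, 2)]card_ord -card_draws.
rewrite -[RHS](cardsID (edges G)); congr (_ + _)%N.
apply: eq_card => x; rewrite !inE.
by case xE: (x \in edges G); rewrite ?andbF // (edges_card xE).
Qed.

End AcyclicityBounds.

(** * From barcode intervals to nonzero homology *)

Section HomologyAcyclicity.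
Variables (K : fieldType) (n : nat) (G : sgraph n).

Lemma chainsP k (c : chain K n) :
  reflect (clique_chain G [set: 'I_n] k.+1 c)
          (c \in chains K (flag_complex G) k).
Proof.
apply: (iffP idP) => [|cc].
  rewrite /chains => /(coord_span (X := in_tuple _)) -> s.
  rewrite sum_ffunE => cs0.
  suff /andP[cs /eqP sk] : is_clique G s && (#|s| == k.+1).
    by split=> //; apply: subsetT.
  apply: contraNT cs0 => not_face; rewrite big1 // => i _.
  have /imageP[t] := mem_nth 0 (ltn_ord i).
  rewrite !inE ffunE /= => ft ->; rewrite ffunE.
  have [st|_] := eqVneq s t; first by rewrite st ft in not_face.
  by rewrite scaler0.
have -> : c = \sum_s c s *: simplex K s.
  apply/ffunP => t; rewrite sum_ffunE (bigD1 t) //= big1.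
    by rewrite addr0 !ffunE eqxx /GRing.scale /= mulr1.
  by move=> s st; rewrite !ffunE eq_sym (negbTE st) scaler0.
apply: memv_suml => s _; have [->|/cc[cs _ sk]] := eqVneq (c s) 0.
  by rewrite scale0r mem0v.
by apply/memvZ/memv_span/image_f; rewrite !inE cs sk eqxx.
Qed.

Lemma acyclic_homology k : acyclic_on K G [set: 'I_n] k.+1 ->
  forall x : homology K (flag_complex G) k, x = 0.
Proof.
move=> aG x; rewrite -[x]hreprK; apply/eqP; rewrite hclass_eq0.
have /[!memv_cap]/andP[/chainsP cz /[!memv_ker]/eqP zz] := subvsP (hrepr x).
by have [d /chainsP cd <-] := aG _ cz zz; apply: memv_img.
Qed.

End HomologyAcyclicity.

(** At index [i] the interval module has the nonzero constant vector [1], indexed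
    by the intervals alive at [i]; its preimage is a nonzero homology class. *)
Lemma alive_not_acyclic (K : fieldType) n m (G : edgewise_filtration n m) k B
    a b i :
    is_barcode (flag_homology K G k) B -> (a, b) \in B -> (a <= i < b)%N ->
  ~ acyclic_on K (graph_at G i) [set: 'I_n] k.+1.
Proof.
move=> [Bwf [phi [phib _]]] abB iab aG.
have /andP[/andP[a0 ab] bm] := Bwf _ _ abB.
have im : (0 < i <= m)%N by lia.
have [psi _ phiK] := phib i im.
have jB : (index (a, b) B < size B)%N by rewrite index_mem.
have al : alive i (Ordinal jB : 'I_(size B)).
  by rewrite /alive (tnth_nth (a, b)) /= nth_index.
pose f : interval_space K B i := [ffun=> 1].
have := phiK f; rewrite (acyclic_homology aG (psi f)) linear0.
move=> /ffunP/(_ (exist (fun j : 'I_(size B) => alive i j) _ al)).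
by rewrite !ffunE => /esym/eqP; rewrite oner_eq0.
Qed.

Theorem corollary21 (K : fieldType) (n m : nat) (G : edgewise_filtration n m)
    (k : nat) (B : seq (nat * nat)) (hB : is_barcode (flag_homology K G k) B)
    (a b : nat) (hab : (a, b) \in B) :
  (2 * k * (k + 1) <= a)%N /\ (a < b)%N /\ (b <= 'C(n - 1, 2) + k + 1)%N.
Proof.
have /andP[/andP[a0 ab] bm] := hB.1 _ _ hab.
split; [|split=> //].
  have ea : #|edges (graph_at G a)| = a by apply: graph_at_card; lia.
  rewrite leqNgt; apply/negP => ak.
  apply: (alive_not_acyclic hB hab (i := a)); first by lia.
  by apply: acyclic_few_edges; rewrite pairs_inT ea.
(* The last index at which the interval is alive is [i = b - 1]. *)
case: b => // i in hab ab bm *.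
have ei : #|edges (graph_at G i)| = i by apply: graph_at_card; lia.
have en := card_edges_nonedges (graph_at G i).
have many : (n <= #|nonedges (graph_at G i)| + k.+1)%N.
  rewrite leqNgt; apply/negP => nk.
  apply: (alive_not_acyclic hB hab (i := i)); first by lia.
  by apply: acyclic_few_nonedges; rewrite pairs_inT cardsT card_ord.
(* For [n = 0] the count of nonedges gives only [i <= k + 1], because [n - 1]
   truncates; but then there are no edges at all, while [i >= a > 0]. *)
case: n G hB ei en many => [|n] G hB ei en many.
  by rewrite bin0n in en; lia.
rewrite binS bin1 in en; rewrite subn1 /=; card_lia.
Qed.
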